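(* For every fixed integer $k\ge 2$ and every fixed $\epsilon>0$ there is a polynomial-time algorithm that, given any normalized $k$-ary string $s$ (say fully $k'$-ary for some $k'\le k$), computes a sequence of flips transforming $s$ into a string of length $k'$ using at most $(1+\epsilon)\,d_{\rm g}(s)$ flips.
   Context: Strings are finite words over $\{0,1,2,\dots\}$; a $k$-ary string uses only symbols from $\{0,\dots,k-1\}$. A string is \emph{normalized} if no two adjacent symbols are equal; the \emph{normalization} of a string replaces every maximal run of identical symbols by a single copy. A string is \emph{fully $k$-ary} if the set of symbols occurring in it is exactly $\{0,\dots,k-1\}$. For a normalized string $s=s_1\cdots s_n$ and $1\le i\le n$, the flip $f^{(i)}(s)$ is the normalization of $s_i\cdots s_1 s_{i+1}\cdots s_n$. The grouping distance $d_{\rm g}(s)$ of a normalized fully $k'$-ary string is the minimum number of flips needed to transform $s$ into a string of length $k'$. *)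

(* Defs.v *)
From Stdlib Require Import Reals.
From mathcomp Require Import all_boot.

Set Implicit Arguments.
Unset Strict Implicit.
Unset Printing Implicit Defensive.

Definition kary (k : nat) (s : seq nat) : bool := all (fun x => x < k) s.

Definition normalized (s : seq nat) : bool := sorted (fun a b : nat => a != b) s.

Fixpoint normalize (s : seq nat) : seq nat :=
  match s with
  | [::] => [::]
  | x :: s' =>
      match normalize s' with
      | [::] => [:: x]
      | y :: t => if x == y then y :: t else x :: y :: t
      end
  end.

Definition fully_kary (k : nat) (s : seq nat) : Prop :=
  forall x : nat, (x \in s) = (x < k).

Definition flip (i : nat) (s : seq nat) : seq nat :=
  normalize (rev (take i s) ++ drop i s).

Fixpoint apply_flips (fl : seq nat) (s : seq nat) : option (seq nat) :=
  match fl with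
  | [::] => Some s
  | i :: fl' => if (1 <= i) && (i <= size s) then apply_flips fl' (flip i s)
                else None
  end.

Definition groups_with (k' : nat) (s : seq nat) (fl : seq nat) : Prop :=
  exists t, apply_flips fl s = Some t /\ size t = k'.

Definition groupable_in (k' : nat) (s : seq nat) (m : nat) : Prop :=
  exists fl, size fl = m /\ groups_with k' s fl.

Definition is_grouping_distance (k' : nat) (s : seq nat) (d : nat) : Prop :=
  groupable_in k' s d /\ (forall m, groupable_in k' s m -> d <= m).

Inductive move := MvL | MvR | MvS.

(* states 'I_(tm_Q.+1) with start state ord0; tape symbols 'I_(tm_S.+1)
   with blank = 0.  delta q a = None means "halt". *)
Record TM := mkTM {
  tm_Q : nat;
  tm_S : nat;
  tm_delta : 'I_tm_Q.+1 -> 'I_tm_S.+1 -> option ('I_tm_Q.+1 * 'I_tm_S.+1 * move)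
}.

(* configuration: state, left part (reversed, nearest cell first),
   scanned symbol, right part *)
Record config (M : TM) := mkConfig {
  c_state : 'I_(tm_Q M).+1;
  c_left : seq 'I_(tm_S M).+1;
  c_head : 'I_(tm_S M).+1;
  c_right : seq 'I_(tm_S M).+1
}.

Definition blank (M : TM) : 'I_(tm_S M).+1 := ord0.

Definition step (M : TM) (c : config M) : option (config M) :=
  match tm_delta (c_state c) (c_head c) with
  | None => None
  | Some (q', b, mv) =>
      let l := c_left c in
      let r := c_right c in
      Some match mv with
      | MvS => mkConfig q' l b r
      | MvL => match l with
               | [::] => mkConfig q' [::] (blank M) (b :: r)
               | x :: l' => mkConfig q' l' x (b :: r)
               end
      | MvR => match r with
               | [::] => mkConfig q' (b :: l) (blank M) [::]
               | x :: r' => mkConfig q' (b :: l) x r'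
               end
      end
  end.

Fixpoint run (M : TM) (t : nat) (c : config M) : option (config M) :=
  match t with
  | 0 => None
  | t'.+1 => match step c with
             | None => Some c
             | Some c' => run t' c'
             end
  end.

(* input encoding: symbol x is written as tape symbol x+1 (0 is blank);
   the head starts on the first input cell in state ord0 *)
Definition enc_sym (M : TM) (x : nat) : 'I_(tm_S M).+1 := inord x.+1.

Definition init_config (M : TM) (s : seq nat) : config M :=
  match map (@enc_sym M) s with
  | [::] => mkConfig ord0 [::] (blank M) [::]
  | a :: w => mkConfig ord0 [::] a w
  end.

(* output: the non-blank word starting at the head, over {1,2}, read as a
   list of natural numbers written in unary (1 = tally, 2 = terminator) *)
Fixpoint decode_unary (acc : nat) (w : seq nat) : option (seq nat) :=
  match w with
  | [::] => if acc == 0 then Some [::] else None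
  | x :: w' =>
      if x == 1 then decode_unary acc.+1 w'
      else if x == 2 then
        match decode_unary 0 w' with
        | Some l => Some (acc :: l)
        | None => None
        end
      else None
  end.

Definition output (M : TM) (c : config M) : option (seq nat) :=
  let w := map (@nat_of_ord _) (c_head c :: c_right c) in
  decode_unary 0 (take (find (fun x => x == 0) w) w).

Definition computes_within (M : TM) (s : seq nat) (t : nat) (fl : seq nat) : Prop :=
  exists c, run t (init_config M s) = Some c /\ output c = Some fl.

(* Main.v *)
(* Each flip of a normalized string of length [n] shortens it by at most one, so
   the grouping distance is at least [n - k'].  Conversely [n] flips suffice: if
   the first symbol occurs again, the flip ending just before its next
   occurrence merges the two copies; otherwise the flip of the whole string puts
   this symbol at the end, where it is never touched again.  Hence the greedy
   sequence is within a factor [1 + eps] of the optimum unless [n] is bounded in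
   terms of [k] and [eps], and for those finitely many strings optimal sequences
   are stored in the finite control of the machine. *)

Require Import Defs.
From HB Require Import structures.
From Stdlib Require Import Reals Classical Lra.
From mathcomp Require Import all_boot zify.

Set Implicit Arguments.
Unset Strict Implicit.
Unset Printing Implicit Defensive.

(** * The grouping distance lies between [n - k'] and [n] *)

Lemma normalize_cons (x : nat) (t : seq nat) :
  exists t', normalize (x :: t) = x :: t'.
Proof.
rewrite /=; case: (normalize t) => [|y t']; first by exists [::].
by case: eqP => [->|_]; eexists.
Qed.

Lemma normalize_cons_neq (x y : nat) (t : seq nat) : x != y ->
  normalize (x :: y :: t) = x :: normalize (y :: t).
Proof.
move=> nxy; have [t' E] := normalize_cons y t.
rewrite -[LHS]/(match normalize (y :: t) with
  | [::] => [:: x]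
  | z :: t'' => if x == z then z :: t'' else x :: z :: t'' end).
by rewrite E (negPf nxy).
Qed.

Lemma normalized_normalize (s : seq nat) : normalized (normalize s).
Proof.
elim: s => [|x s] //=; case: (normalize s) => [|y t] //= IH.
by case: eqP => //= /eqP ->.
Qed.

Lemma normalize_id (s : seq nat) : normalized s -> normalize s = s.
Proof.
elim: s => [|x [|y s] IH] // /andP[nxy sy].
by rewrite normalize_cons_neq // IH.
Qed.

Lemma mem_normalize (s : seq nat) : normalize s =i s.
Proof.
elim: s => [|x s IH] //= z; rewrite !inE -IH.
by case: (normalize s) => [|y t] //=; case: eqP => [->|_]; rewrite !inE // orbA orbb.
Qed.

Lemma normalized_cat_cons (u v : seq nat) (a : nat) :
  normalized (u ++ a :: v) = normalized (rcons u a) && normalized (a :: v).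
Proof.
by case: u => [|x u] //=; rewrite /normalized /= cat_path rcons_path /= andbA.
Qed.

Lemma normalized_rev (s : seq nat) : normalized (rev s) = normalized s.
Proof. by rewrite /normalized rev_sorted; apply: eq_sorted => x y; rewrite eq_sym. Qed.

Lemma normalize_cat_dup (u v : seq nat) (a : nat) :
  normalize (u ++ a :: a :: v) = normalize (u ++ a :: v).
Proof.
elim: u => [|x u IH] /=; last by rewrite -/(normalize _) IH.
by case: (normalize v) => [|y t]; rewrite ?eqxx //; case: (altP (a =P y)) => [->|_]; rewrite eqxx.
Qed.

(** Only the two symbols meeting at the junction can coincide, so at most one symbol is lost. *)
Lemma size_normalize_cat (u v : seq nat) : normalized u -> normalized v ->
  size u + size v <= (size (normalize (u ++ v))).+1.
Proof.
elim: u => [|x [|y u] IH] nu nv.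
- by rewrite normalize_id.
- rewrite /= (normalize_id nv); case: (v) nv => [|y t] //= _.
  by case: eqP => _ /=; lia.
- have /andP[nxy nyu] := nu; rewrite !cat_cons normalize_cons_neq //= addSn ltnS.
  exact: IH nyu nv.
Qed.

Lemma normalized_take (i : nat) (s : seq nat) : normalized s -> normalized (take i s).
Proof. exact: take_sorted. Qed.

Lemma normalized_drop (i : nat) (s : seq nat) : normalized s -> normalized (drop i s).
Proof. exact: drop_sorted. Qed.

Lemma size_flip (i : nat) (s : seq nat) : normalized s -> size s <= (size (flip i s)).+1.
Proof.
move=> ns; rewrite -{1}(cat_take_drop i s) size_cat -(size_rev (take i s)).
by apply: size_normalize_cat; rewrite ?normalized_rev ?normalized_take ?normalized_drop.
Qed.

Lemma size_apply_flips (fl s t : seq nat) : normalized s ->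
  apply_flips fl s = Some t -> size s <= size t + size fl.
Proof.
elim: fl s => [|i fl IH] s ns /=; first by case=> ->; rewrite addn0.
case: ifP => // _ /IH -/(_ (normalized_normalize _)) le_t.
by apply: leq_trans (size_flip i ns) _; rewrite addnS.
Qed.

Lemma groupable_lower_bound (k' m : nat) (s : seq nat) : normalized s ->
  groupable_in k' s m -> size s <= k' + m.
Proof. by move=> ns [fl [<- [t [/(size_apply_flips ns) + <-]]]]. Qed.

(* [w] omits the symbols already grouped at the end of the string.  If [a] does
   not recur, then [j = size r] and the flip moves [a] out of the working
   string, so both cases share one formula.  [m] is fuel. *)
Fixpoint greedy (m : nat) (w : seq nat) : seq nat :=
  match m, w with
  | m'.+1, a :: r =>
      let j := index a r in j.+1 :: greedy m' (rev (take j r) ++ drop j r)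
  | _, _ => [::]
  end.

(** [p] collects the settled symbols. If [a] recurs in [r], the flip brings it next to its second
    copy and [p] stays; otherwise all of [r] is reversed and [a] is settled too, giving [a :: p]. *)
Lemma greedy_flip (a : nat) (r p : seq nat) : let j := index a r in
  normalized (a :: r ++ p) -> uniq p -> (forall x, x \in p -> x \notin a :: r) ->
  exists p', [/\ flip j.+1 (a :: r ++ p) = (rev (take j r) ++ drop j r) ++ p',
    uniq p' & forall x, x \in p' -> x \notin rev (take j r) ++ drop j r].
Proof.
move=> j ns up dj.
have tk : take j.+1 (a :: r ++ p) = a :: take j r.
  by rewrite /= takel_cat // index_size.
have dk : drop j.+1 (a :: r ++ p) = drop j r ++ p.
  have := cat_take_drop j.+1 (a :: r ++ p).
  by rewrite tk -{3}(cat_take_drop j r) /= -catA => -[] /eqP; rewrite eqseq_cat // eqxx => /eqP.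
have ra : rev (take j.+1 (a :: r ++ p)) = rcons (rev (take j r)) a.
  by rewrite tk rev_cons.
have nL : normalized (rcons (rev (take j r)) a).
  by rewrite -ra normalized_rev normalized_take.
have nR : normalized (drop j r ++ p) by rewrite -dk normalized_drop.
rewrite /flip ra dk cat_rcons.
have [ar|ar] := boolP (a \in r).
- have dr : drop j r = a :: drop j.+1 r by rewrite (drop_nth a) ?index_mem // nth_index.
  exists p; split=> //.
  + rewrite -catA dr /= normalize_cat_dup normalize_id //.
    by rewrite normalized_cat_cons nL -cat_cons -dr.
  + move=> x /dj; apply: contra.
    by rewrite mem_cat mem_rev -mem_cat cat_take_drop inE orbC => ->.
- have jr : j = size r by rewrite /j memNindex.
  rewrite jr take_size drop_size /= cats0 in nL nR *.
  have ap : a \notin p by apply/negP => /dj; rewrite mem_head.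
  exists (a :: p); split.
  + rewrite normalize_id // normalized_cat_cons nL.
    case: (p) nR ap => [|y p'] // nR; rewrite inE negb_or => /andP[ay _].
    by rewrite /normalized /= ay.
  + by rewrite /= ap.
  + move=> x; rewrite inE mem_rev => /orP[/eqP->//|/dj].
    by rewrite inE negb_or => /andP[].
Qed.

(** Each flip shortens the working string by one symbol, so after [m] flips only the duplicate-free
    suffix is left. *)
Lemma apply_greedy (m : nat) (w p : seq nat) : size w = m ->
  normalized (w ++ p) -> uniq p -> (forall x, x \in p -> x \notin w) ->
  exists t, [/\ apply_flips (greedy m w) (w ++ p) = Some t, uniq t & t =i w ++ p].
Proof.
elim: m w p => [|m IH] w p; first by move/size0nil=> -> _ up _; exists p.
case: w => [|a r] // [sr] ns up dj.
have [p' [E up' dj']] := greedy_flip ns up dj.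
set j := index a r in E dj' *.
have sr' : size (rev (take j r) ++ drop j r) = m.
  by rewrite size_cat size_rev -size_cat cat_take_drop.
have nE : normalized ((rev (take j r) ++ drop j r) ++ p').
  by rewrite -E normalized_normalize.
have [t [Et ut mt]] := IH _ p' sr' nE up' dj'.
exists t; split=> //.
- rewrite /= -/j E Et ifT //.
  by rewrite size_cat (leq_ltn_trans _ (leq_addr _ _)) ?index_size.
- move=> x; rewrite mt -E mem_normalize mem_cat mem_rev -mem_cat cat_take_drop //.
Qed.

Lemma size_greedy (m : nat) (w : seq nat) : size w = m -> size (greedy m w) = m.
Proof.
elim: m w => [|m IH] [|a r] //= [sr]; rewrite IH // size_cat size_rev.
by rewrite -size_cat cat_take_drop.
Qed.

Lemma fully_kary_card (k' : nat) (s t : seq nat) :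
  fully_kary k' s -> uniq t -> t =i s -> size t = k'.
Proof.
move=> fs ut ts; rewrite -(size_iota 0 k'); apply/perm_size/uniq_perm => //.
  exact: iota_uniq.
by move=> x; rewrite ts fs mem_iota.
Qed.

Lemma groups_with_greedy (k' : nat) (s : seq nat) :
  normalized s -> fully_kary k' s -> groups_with k' s (greedy (size s) s).
Proof.
move=> ns fs; have ns0 : normalized (s ++ [::]) by rewrite cats0.
have [//|//|t [Et ut mt]] := @apply_greedy _ s [::] erefl ns0.
rewrite cats0 in Et mt.
by exists t; split=> //; apply: fully_kary_card mt.
Qed.

(** The sequence is chosen before [k'], which [s] determines, so that it can be tabulated by [s]
    alone. Classical existence suffices, since the answers are hardwired into a finite machine. *)
Lemma optimal_grouping (s : seq nat) : exists fl : seq nat, forall k',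
  normalized s -> fully_kary k' s ->
  groups_with k' s fl /\ forall m, groupable_in k' s m -> size fl <= m.
Proof.
have [[k' [ns fs]]|no] := classic (exists k', normalized s /\ fully_kary k' s); last first.
  by exists [::] => k' ns fs; case: no; exists k'.
suff [fl [gfl mfl]] : exists fl, groups_with k' s fl /\
    forall m, groupable_in k' s m -> size fl <= m.
  exists fl => k2 _ fs2.
  suff -> : k2 = k' by [].
  have Hk x : (x < k2) = (x < k') by rewrite -fs2 fs.
  by have := Hk k'; have := Hk k2; rewrite !ltnn; lia.
(* Descent on length, starting from the greedy sequence, ends at a shortest one. *)
have [n] := ubnP (size (greedy (size s) s)).
have := groups_with_greedy ns fs; move: (greedy _ _) => fl.
elim: n fl => // n IH fl gfl lt_fl.
have [[m [[fl' [<- gfl']] lt_m]]|no] :=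
  classic (exists m, groupable_in k' s m /\ m < size fl).
  by apply: (IH fl' gfl'); lia.
exists fl; split=> // m gm; rewrite leqNgt; apply/negP => lt_m.
by apply: no; exists m.
Qed.

(** * Turing machines over an arbitrary finite state type *)

Lemma computes_within_le (M : TM) (s : seq nat) (T T' : nat) (fl : seq nat) :
  T <= T' -> computes_within M s T fl -> computes_within M s T' fl.
Proof.
move=> le_T [c [rc oc]]; exists c; split=> //; move: rc.
elim: T T' le_T (init_config M s) => [|T IH] [|T'] //= le_T d.
by case: (step d) => // d'; apply: IH.
Qed.

(* Configurations [(q, l, r)] carry tape symbols as natural numbers; the scanned
   cell is the head of [r], and an empty [r] stands for a blank scanned cell. *)
Section AbstractMachine.

Variables (Q : finType) (S : nat) (q0 : Q).
Variable delta : Q -> nat -> option (Q * nat * move).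

Definition acfg : Type := (Q * seq nat * seq nat)%type.

Definition move_left (q : Q) (l r : seq nat) : acfg :=
  (q, behead l, head 0 l :: r).

Definition astep (c : acfg) : option acfg :=
  let: (q, l, r) := c in
  if delta q (head 0 r) is Some (q', b, mv) then
    Some match mv with
    | MvS => (q', l, b :: behead r)
    | MvL => move_left q' l (b :: behead r)
    | MvR => (q', b :: l, behead r)
    end
  else None.

Inductive reach : nat -> acfg -> acfg -> Prop :=
| reach_refl T c : reach T c c
| reach_step T c c' c'' : astep c = Some c' -> reach T c' c'' -> reach T.+1 c c''.

Lemma reach_le T T' c c' : T <= T' -> reach T c c' -> reach T' c c'.
Proof.
move=> + rc; elim: rc T' => [T0 c0|T0 c0 c1 c2 e _ IH] T'; first by constructor.
by case: T' => // T' /IH; apply: reach_step.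
Qed.

Lemma reach_trans T T' c c' c'' :
  reach T c c' -> reach T' c' c'' -> reach (T + T') c c''.
Proof.
move=> rc; elim: rc c'' => [T0 c0|T0 c0 c1 c2 e _ IH] c3 r'.
  by apply: reach_le r'; apply: leq_addl.
by rewrite addSn; apply: reach_step e (IH _ r').
Qed.

Lemma sweep_right q w l r : (forall x, x \in w -> delta q x = Some (q, x, MvR)) ->
  reach (size w) (q, l, w ++ r) (q, rev w ++ l, r).
Proof.
elim: w l => [|x w IH] l dw; first exact: reach_refl.
rewrite rev_cons cat_rcons; apply: reach_step.
  by rewrite /= dw ?mem_head.
by apply: IH => y yw; rewrite dw // inE yw orbT.
Qed.

(** Writing both ends with [move_left] lets the sweep stop on a blank when [l] is empty, without a
    separate case. *)
Lemma sweep_left q w l r : (forall x, x \in w -> delta q x = Some (q, x, MvL)) ->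
  reach (size w) (move_left q (w ++ l) r) (move_left q l (rev w ++ r)).
Proof.
elim: w r => [|x w IH] r dw; first exact: reach_refl.
rewrite rev_cons cat_rcons; apply: reach_step.
  by rewrite /= dw ?mem_head.
by apply: IH => y yw; rewrite dw // inE yw orbT.
Qed.

(* [ord0], the start state, is an extra copy of [q0]. *)
Definition state_of (i : 'I_#|Q|.+1) : Q :=
  if unlift ord0 i is Some j then enum_val j else q0.

Definition state_code (q : Q) : 'I_#|Q|.+1 := lift ord0 (enum_rank q).

Lemma state_codeK : cancel state_code state_of.
Proof. by move=> q; rewrite /state_of /state_code liftK enum_rankK. Qed.

Definition machine : TM :=
  @mkTM #|Q| S (fun i x =>
    if delta (state_of i) x is Some (q, b, mv) then Some (state_code q, inord b, mv)
    else None).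

Hypothesis delta_bound : forall q x q' b mv,
  x <= S -> delta q x = Some (q', b, mv) -> b <= S.

Definition tape_config (i : 'I_#|Q|.+1) (l r : seq 'I_S.+1) : config machine :=
  @mkConfig machine i l (head ord0 r) (behead r).

Lemma val_head (r : seq 'I_S.+1) : head 0 (map val r) = val (head ord0 r).
Proof. by case: r. Qed.

Lemma step_machine i l r c' :
  astep (state_of i, map val l, map val r) = Some c' ->
  exists i' l' r', step (tape_config i l r) = Some (tape_config i' l' r') /\
    c' = (state_of i', map val l', map val r').
Proof.
rewrite /= val_head /step /=.
case E: (delta _ _) => [[[q b] mv]|] //= [<-] {c'}.
have vb : val (inord b : 'I_S.+1) = b.
  by rewrite /= inordK // ltnS; apply: delta_bound E; rewrite -ltnS.
case: mv E => E.
- case: l => [|x l].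
    exists (state_code q), [::], [:: ord0, inord b & behead r]; split=> //.
    by rewrite /move_left /= state_codeK vb behead_map.
  exists (state_code q), l, [:: x, inord b & behead r]; split=> //.
  by rewrite /move_left /= state_codeK vb behead_map.
- exists (state_code q), (inord b :: l), (behead r); split.
    by case: (behead r).
  by rewrite /= state_codeK vb behead_map.
- exists (state_code q), l, (inord b :: behead r); split=> //.
  by rewrite /= state_codeK vb behead_map.
Qed.

(** The extra unit of fuel pays for the call of [step] that detects the halt. *)
Lemma run_machine T i l r q' l' o :
  reach T (state_of i, map val l, map val r) (q', l', o) ->
  (forall x, delta q' x = None) ->
  exists c, run T.+1 (tape_config i l r) = Some c /\
    output c = decode_unary 0 (take (find (fun x => x == 0) o) o).
Proof.
move=> + halt.
move Ec: (state_of i, map val l, map val r) => c.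
move Ec': (q', l', o) => c' rc.
elim: rc i l r Ec Ec' => {c c' T} [T c|T c c' c'' e _ IH] i l r Ec Ec'.
  move: Ec; rewrite -Ec' => -[Eq _ Eo]; exists (tape_config i l r); split.
    by rewrite /= /step /= Eq halt.
  by rewrite /output /= -Eo; case: (r).
move: e; rewrite -Ec => /step_machine [i' [l1 [r1 [st Ec1]]]].
have [d [rd od]] := IH i' l1 r1 (esym Ec1) Ec'.
by exists d; split; last by []; rewrite -rd /= st.
Qed.

Lemma machine_computes T s l' q' r fl : all (fun x => x < S) s ->
  reach T (q0, [::], map succn s) (q', l', r) -> (forall x, delta q' x = None) ->
  decode_unary 0 (take (find (fun x => x == 0) r) r) = Some fl ->
  computes_within machine s T.+1 fl.
Proof.
move=> ks rT halt dec.
have E : init_config machine s = tape_config ord0 [::] (map (@enc_sym machine) s).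
  by rewrite /init_config; case: s {ks rT}.
have V : map val (map (@enc_sym machine) s) = map succn s.
  rewrite -map_comp; apply/eq_in_map => x /(allP ks) xS.
  by rewrite /= inordK.
have q0E : state_of ord0 = q0 by rewrite /state_of unlift_none.
move: rT; rewrite -V -q0E => rT; have [c [rc oc]] := run_machine (l := [::]) rT halt.
by exists c; split; [rewrite E | rewrite oc].
Qed.

End AbstractMachine.

(** * Unary output words *)

Definition flip_word (fl : seq nat) : seq nat :=
  flatten [seq rcons (nseq i 1) 2 | i <- fl].

Lemma flip_word_bound (fl : seq nat) : all (fun x => 0 < x <= 2) (flip_word fl).
Proof.
elim: fl => // i fl; rewrite /flip_word /= all_cat all_rcons /= => ->.
by rewrite all_nseq orbT.
Qed.

Lemma decode_flip_word (fl : seq nat) : decode_unary 0 (flip_word fl) = Some fl.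
Proof.
elim: fl => // i fl IH; rewrite /flip_word /= cat_rcons -/(flip_word fl).
suff H acc : decode_unary acc (nseq i 1 ++ 2 :: flip_word fl) = Some (acc + i :: fl).
  by rewrite H.
elim: i acc => [|i IHi] acc /=; first by rewrite IH addn0.
by rewrite IHi addSnnS.
Qed.

Lemma take_flip_word (fl : seq nat) : let w := flip_word fl in
  take (find (fun x => x == 0) w) w = w.
Proof.
move=> w; apply: take_oversize; rewrite leqNgt -has_find.
by apply/hasPn => x /(allP (flip_word_bound fl)); lia.
Qed.

(** * The machine of the approximation scheme *)

(* The tape holds the working string, a separator and the output.  Removed
   symbols leave holes.  A flip replaces the first symbol [a] by a mark (keeping
   [a] in the state) and carries the symbols after it one by one to the left end
   of the tape, appending a tally to the output for each, until it meets the
   separator or a second copy of [a]. *)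
Inductive state (k N B : nat) : Type :=
| Read of N.-bseq 'I_k.+1
| Write of N.-bseq 'I_k.+1 & 'I_B.+1
| ToEnd | Rewind | Start
| TallyR of 'I_k.+1
| TallyL of 'I_k.+1
| Fetch of 'I_k.+1
| Carry of 'I_k.+1 & 'I_k.+1
| Close | Done.

Arguments Read {k N B}. Arguments Write {k N B}. Arguments ToEnd {k N B}.
Arguments Rewind {k N B}. Arguments Start {k N B}. Arguments TallyR {k N B}.
Arguments TallyL {k N B}. Arguments Fetch {k N B}. Arguments Carry {k N B}.
Arguments Close {k N B}. Arguments Done {k N B}.

(** A sum of finite types from which [state] inherits its finite structure: ['I_5] numbers the
    constructors without argument, ['I_3] those carrying one symbol. *)
Definition state_rep (k N B : nat) : Type :=
  (N.-bseq 'I_k.+1 + N.-bseq 'I_k.+1 * 'I_B.+1 + 'I_5 + 'I_3 * 'I_k.+1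
   + 'I_k.+1 * 'I_k.+1)%type.

Definition state_to_rep (k N B : nat) (q : state k N B) : state_rep k N B :=
  match q with
  | Read p => inl (inl (inl (inl p)))
  | Write p m => inl (inl (inl (inr (p, m))))
  | ToEnd => inl (inl (inr (inord 0)))
  | Rewind => inl (inl (inr (inord 1)))
  | Start => inl (inl (inr (inord 2)))
  | Close => inl (inl (inr (inord 3)))
  | Done => inl (inl (inr (inord 4)))
  | TallyR a => inl (inr (inord 0, a))
  | TallyL a => inl (inr (inord 1, a))
  | Fetch a => inl (inr (inord 2, a))
  | Carry a b => inr (a, b)
  end.

Definition state_of_rep (k N B : nat) (u : state_rep k N B) : state k N B :=
  match u with
  | inl (inl (inl (inl p))) => Read p
  | inl (inl (inl (inr (p, m)))) => Write p m
  | inl (inl (inr i)) => nth Done [:: ToEnd; Rewind; Start; Close; Done] i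
  | inl (inr (i, a)) => nth Done [:: TallyR a; TallyL a; Fetch a] i
  | inr (a, b) => Carry a b
  end.

Lemma state_to_repK (k N B : nat) : cancel (@state_to_rep k N B) (@state_of_rep k N B).
Proof. by case=> * //=; rewrite inordK. Qed.

HB.instance Definition _ (k N B : nat) :=
  Equality.copy (state k N B) (can_type (@state_to_repK k N B)).
HB.instance Definition _ (k N B : nat) :=
  Choice.copy (state k N B) (can_type (@state_to_repK k N B)).
HB.instance Definition _ (k N B : nat) :=
  Countable.copy (state k N B) (can_type (@state_to_repK k N B)).
HB.instance Definition _ (k N B : nat) :=
  Finite.copy (state k N B) (can_type (@state_to_repK k N B)).

Section GroupingMachine.

Variables (k N B : nat) (table : N.-bseq 'I_k.+1 -> seq nat).

(* Codes [1..k] are the symbols, shifted by one. *)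
Local Notation hole := k.+1.
Local Notation sep := k.+2.
Local Notation mark := k.+3.
Local Notation state := (state k N B).

(** [Read] stores up to [N] symbols in the state. A blank met there means a short input: [Write]
    lays down the tabulated answer from its last symbol to its first, so that the head ends on its
    first cell. A further symbol starts the greedy phase. [Rewind] turns the mark into a hole and
    fills the blank at the left end with another. *)
Definition delta (q : state) (x : nat) : option (state * nat * move) :=
  match q with
  | Read p =>
      if x == 0 then Some (Write p (inord (size (flip_word (table p)))), 0, MvS)
      else if size p < N then Some (Read (insub_bseq N (rcons p (inord x))), x, MvR)
      else Some (ToEnd, x, MvR)
  | Write p m =>
      if (m : nat) is m'.+1 then
        Some (Write p (inord m'), nth 0 (flip_word (table p)) m',
              if m' == 0 then MvS else MvL)
      else None
  | ToEnd => if x == 0 then Some (Rewind, sep, MvL) else Some (ToEnd, x, MvR)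
  | Rewind =>
      if x == 0 then Some (Start, hole, MvR)
      else if x == mark then Some (Rewind, hole, MvL) else Some (Rewind, x, MvL)
  | Start =>
      if x == hole then Some (Start, x, MvR)
      else if x == sep then Some (Done, x, MvR)
      else Some (TallyR (inord x), mark, MvR)
  | TallyR a => if x == 0 then Some (TallyL a, 1, MvL) else Some (TallyR a, x, MvR)
  | TallyL a => if x == mark then Some (Fetch a, x, MvR) else Some (TallyL a, x, MvL)
  | Fetch a =>
      if x == hole then Some (Fetch a, x, MvR)
      else if (x == sep) || (x == a) then Some (Close, x, MvR)
      else Some (Carry a (inord x), hole, MvL)
  | Carry a b => if x == 0 then Some (TallyR a, (b : nat), MvR) else Some (Carry a b, x, MvL)
  | Close => if x == 0 then Some (Rewind, 2, MvL) else Some (Close, x, MvR)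
  | Done => None
  end.

Lemma delta_bound q x q' b mv : x <= mark -> delta q x = Some (q', b, mv) -> b <= mark.
Proof.
have Hw p m : nth 0 (flip_word (table p)) m <= mark.
  have [lt_m|le_m] := ltnP m (size (flip_word (table p))).
    by have /andP[_ /leq_trans] := allP (flip_word_bound (table p)) _ (mem_nth 0 lt_m); apply.
  by rewrite nth_default.
move=> xS; case: q => [p|p [[|m] ?]||||a|a|a|a b'||] //=;
  repeat case: ifP => _; case=> _ <- _ //; try exact: Hw; try lia.
by have := ltn_ord b'; lia.
Qed.

(** * Tape words and sweeps *)

Local Notation reach := (reach delta).

(** Words that the tally, carry, close and rewind sweeps cross unchanged; only blanks and the mark
    can make these react. *)
Definition clean (X : seq nat) : bool := all (fun x => (x != 0) && (x != mark)) X.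
Definition zone (X : seq nat) : bool := all (fun x => 0 < x <= hole) X.
Definition content (X : seq nat) : seq nat := [seq x <- X | x != hole].

Lemma clean_zone X : zone X -> clean X.
Proof. by apply: sub_all => x; lia. Qed.

Lemma clean_cat X Y : clean (X ++ Y) = clean X && clean Y.
Proof. exact: all_cat. Qed.

Lemma zone_cat X Y : zone (X ++ Y) = zone X && zone Y.
Proof. exact: all_cat. Qed.

Lemma content_cat X Y : content (X ++ Y) = content X ++ content Y.
Proof. exact: filter_cat. Qed.

Lemma clean_rcons X x : clean (rcons X x) = (x != 0) && (x != mark) && clean X.
Proof. exact: all_rcons. Qed.

Lemma zone_holes h : zone (nseq h hole).
Proof. by apply/allP => x /nseqP[-> _]; lia. Qed.

Lemma content_holes h : content (nseq h hole) = [::].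
Proof. by rewrite /content filter_nseq eqxx. Qed.

Lemma zone_first_symbol X : zone X ->
  X = nseq (size X) hole \/
  exists h (b : 'I_k.+1) X', X = nseq h hole ++ (b : nat) :: X' /\ (b : nat) != 0.
Proof.
elim: X => [|x X IH]; first by left.
case/andP=> xb /IH {}IH; have [->|xh] := eqVneq x hole.
  case: IH => [->|[h [b [X' [-> b0]]]]]; first by left; rewrite /= size_nseq.
  by right; exists h.+1, b, X'.
right; have xk : x < hole by lia.
by exists 0, (Ordinal xk), X; split=> //=; lia.
Qed.

Lemma sweep_cleanR q X l r : q = Close \/ (exists a, q = TallyR a) ->
  clean X -> reach (size X) (q, l, X ++ r) (q, rev X ++ l, r).
Proof.
move=> Hq cX; apply: sweep_right => x /(allP cX)/andP[x0 _].
by case: Hq => [->|[a ->]] /=; rewrite (negPf x0).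
Qed.

Lemma sweep_cleanL q X l r :
  [\/ q = Rewind, exists a, q = TallyL a | exists a b, q = Carry a b] ->
  clean X -> reach (size X) (move_left q (rev X ++ l) r) (move_left q l (X ++ r)).
Proof.
move=> Hq cX; rewrite -{3}(revK X) -(size_rev X); apply: sweep_left => x.
rewrite mem_rev => /(allP cX)/andP[x0 xm].
by case: Hq => [->|[a ->]|[a [b ->]]] /=; rewrite ?(negPf x0) ?(negPf xm).
Qed.

(** * Simulation of one flip *)

Lemma reach_tally a l R : clean R ->
  reach (2 * size R + 3) (TallyR a, mark :: l, R) (Fetch a, mark :: l, rcons R 1).
Proof.
move=> cR; apply: (@reach_le _ _ (size R + (size R + 1).+1)); first by lia.
apply: reach_trans.
  by rewrite -{2}(cats0 R); apply: sweep_cleanR => //; right; exists a.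
apply: reach_step; first by [].
apply: reach_trans; first by apply: sweep_cleanL => //; apply: Or32; exists a.
apply: reach_step; first by rewrite /= eqxx.
by rewrite /= -cats1; apply: reach_refl.
Qed.

Lemma reach_carry a (b : 'I_k.+1) h Y R : clean Y -> clean R -> (b : nat) != 0 -> b != a ->
  reach (4 * (size Y + size R + h + 5))
    (Fetch a, mark :: rev Y, nseq h hole ++ (b : nat) :: R)
    (Fetch a, mark :: rev ((b : nat) :: Y), nseq h.+1 hole ++ rcons R 1).
Proof.
move=> cY cR b0 ba; have cH h' := clean_zone (zone_holes h').
(* The summands follow the head: over the holes to [b], back over them, past the mark and over [Y]
   to the left blank, right again past the mark, and then the tally. *)
apply: (@reach_le _ _ (h + (h + (size Y + (size Y + (2 * (size R + h.+1) + 3).+1).+1).+1).+1)).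
  by lia.
apply: reach_trans.
  rewrite -{1}(size_nseq h hole); apply: sweep_right => x /nseqP[-> _] /=.
  by rewrite eqxx.
have bk := ltn_ord b.
apply: reach_step.
  rewrite /= ifF; last by lia.
  rewrite ifF; last by rewrite (negPf (ba : b != a :> nat)); lia.
  by rewrite inord_val.
apply: reach_trans.
  rewrite -{1}(size_nseq h hole); apply: sweep_cleanL => //.
  by apply: Or33; exists a, b.
apply: reach_step; first by [].
apply: reach_trans.
  (* Nothing lies left of [Y], so the head arrives on a blank, where [b] is then written. *)
  rewrite -[rev Y]cats0; apply: sweep_cleanL => //.
  by apply: Or33; exists a, b.
apply: reach_step; first by [].
apply: reach_trans.
  by apply: sweep_cleanR => //; right; exists a.
apply: reach_step; first by [].
have -> : rev Y ++ [:: (b : nat)] = rev ((b : nat) :: Y) by rewrite rev_cons cats1.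
have -> : nseq h.+1 hole ++ rcons R 1 = rcons (nseq h hole ++ hole :: R) 1.
  by rewrite -addn1 nseqD -catA rcons_cat.
have -> : size R + h.+1 = size (nseq h hole ++ hole :: R).
  by rewrite size_cat size_nseq /=; lia.
apply: reach_tally.
by rewrite clean_cat cH /= cR; lia.
Qed.

(** Here [x] is the separator or a second copy of [a]. Both cases end alike: [Rewind] erases the
    mark and with it the first [a], which has either merged with [x] or become settled. *)
Lemma reach_close (a : 'I_k.+1) h x Y R :
  clean Y -> clean R -> x != 0 -> (x == sep) || (x == (a : nat)) ->
  reach (4 * (size Y + size R + h + 5))
    (Fetch a, mark :: rev Y, nseq h hole ++ x :: R)
    (Start, [:: hole], Y ++ hole :: nseq h hole ++ x :: rcons R 2).
Proof.
move=> cY cR x0 xa; have cH h' := clean_zone (zone_holes h').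
have ak := ltn_ord a.
apply: (@reach_le _ _ (h + (size R + (size R + (1 + (h + (size Y + 1).+1))).+1).+1)).
  by lia.
apply: reach_trans.
  rewrite -{1}(size_nseq h hole); apply: sweep_right => y /nseqP[-> _] /=.
  by rewrite eqxx.
apply: reach_step; first by rewrite /= xa ifF //; lia.
apply: reach_trans.
  by rewrite -{2}(cats0 R); apply: sweep_cleanR => //; left.
apply: reach_step; first by [].
apply: reach_trans; first by apply: sweep_cleanL => //; apply: Or31.
apply: reach_trans.
  apply: (@sweep_cleanL _ [:: x]); first exact: Or31.
  by rewrite /= x0; lia.
apply: reach_trans.
  rewrite -{1}(size_nseq h hole); apply: sweep_cleanL => //; exact: Or31.
apply: reach_step; first by rewrite /= eqxx.
apply: reach_trans.
  rewrite -[X in move_left _ X _]cats0; apply: sweep_cleanL => //; exact: Or31.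
apply: reach_step; first by [].
by rewrite -cats1; apply: reach_refl.
Qed.

(** Induction on the number of symbols still to be carried: [reach_carry] moves one to the front of
    [Y], and repeated prepending reverses them; [reach_close] is the base case. *)
Lemma reach_flip (a : 'I_k.+1) j Y Z o :
  zone Y -> zone Z -> clean o -> (a : nat) != 0 -> index (a : nat) (content Z) = j ->
  exists Y' Z', [/\
    reach (j.+1 * (4 * (size Y + size Z + size o + 2 * j + 5)))
      (Fetch a, mark :: rev Y, Z ++ sep :: o)
      (Start, [:: hole], Y' ++ hole :: Z' ++ sep :: o ++ rcons (nseq j 1) 2),
    content Y' = rev (take j (content Z)) ++ content Y,
    content Z' = drop j (content Z), zone (Y' ++ Z')
    & size Y' = size Y + j /\ size Z' = size Z].
Proof.
elim: j Y Z o => [|j IH] Y Z o zY zZ co a0 Ej.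
- have [h [x [R [EW x0 xa cR sW]]]] : exists h x R, [/\ Z ++ sep :: o = nseq h hole ++ x :: R,
      x != 0, (x == sep) || (x == a), clean R & (h + size R = size Z + size o)%N].
    have [EZ|[h [b [Z' [EZ b0]]]]] := zone_first_symbol zZ.
      by exists (size Z), sep, o; split=> //; [rewrite -EZ | rewrite eqxx].
    have bk := ltn_ord b.
    have ab : b = a :> nat.
      move: Ej; rewrite EZ content_cat content_holes /= ifT; last by lia.
      by rewrite /=; case: eqP.
    exists h, b, (Z' ++ sep :: o); split=> //.
    + by rewrite EZ -catA.
    + by rewrite ab eqxx orbT.
    + move: zZ; rewrite EZ zone_cat /= => /and3P[_ _ zZ'].
      by rewrite clean_cat clean_zone //= co; lia.
    + by rewrite EZ !size_cat size_nseq /=; lia.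
  exists Y, Z; split=> //; last by rewrite addn0.
  + have Er : Z ++ sep :: o ++ rcons (nseq 0 1) 2 = nseq h hole ++ x :: rcons R 2.
      by rewrite -rcons_cons -[RHS]rcons_cat -EW -[RHS]cats1 -catA.
    rewrite Er EW; apply: reach_le (reach_close _ (clean_zone zY) cR x0 xa).
    by lia.
  + by rewrite take0.
  + by rewrite drop0.
  + by rewrite zone_cat zY.
- have [EZ|[h [b [Z' [EZ b0]]]]] := zone_first_symbol zZ.
    by move: Ej; rewrite EZ content_holes.
  have bk := ltn_ord b.
  have cZ : content Z = (b : nat) :: content Z'.
    by rewrite EZ content_cat content_holes /= ifT //; lia.
  move: Ej; rewrite cZ /=; case: eqP => // ba [Ej].
  have zZ' : zone Z' by move: zZ; rewrite EZ zone_cat /= => /and3P[].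
  have cR : clean (Z' ++ sep :: o) by rewrite clean_cat clean_zone //= co; lia.
  have cZ1 : content (nseq h.+1 hole ++ Z') = content Z'.
    by rewrite content_cat content_holes.
  have [|||//||Y1 [Z1 [r1 cY1 cZ1' z1 [sY1 sZ1]]]] :=
    IH ((b : nat) :: Y) (nseq h.+1 hole ++ Z') (rcons o 1).
  + by rewrite /= zY andbT; lia.
  + by rewrite zone_cat zone_holes.
  + by rewrite clean_rcons co; lia.
  + by rewrite cZ1.
  exists Y1, Z1; split=> //.
  + have := reach_carry h (clean_zone zY) cR b0 (introN eqP (fun e => ba (congr1 val e))).
    have -> : nseq h hole ++ (b : nat) :: Z' ++ sep :: o = Z ++ sep :: o by rewrite EZ -catA.
    rewrite rcons_cat rcons_cons catA => rc.
    have -> : sep :: o ++ 1 :: rcons (nseq j 1) 2 = sep :: rcons o 1 ++ rcons (nseq j 1) 2.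
      by rewrite cat_rcons.
    apply: reach_le (reach_trans rc r1).
    (* A carry leaves [size Y + size o + 2 * j] unchanged: [Y] and [o] each gain a cell while [j]
       drops by one. So every carry is charged the same amount. *)
    rewrite EZ !(size_cat, size_nseq, size_rcons) /=.
    nia.
  + by rewrite cY1 cZ1 /= rev_cons cat_rcons ifT //; lia.
  + by rewrite cZ1' cZ1.
  + by rewrite sY1 sZ1 EZ !size_cat !size_nseq /=; lia.
Qed.

Lemma reach_round n X o a r : zone X -> clean o -> content X = a :: r -> size r < n ->
  let j := index a r in
  exists X', [/\
    reach (6 * n * (size X + size o + 2 * n + 8))
      (Start, [:: hole], X ++ sep :: o)
      (Start, [:: hole], X' ++ sep :: o ++ rcons (nseq j.+1 1) 2),
    content X' = rev (take j r) ++ drop j r, zone X' & size X' = size X + j.+1].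
Proof.
move=> zX co cX rn j.
have [EX|[h [b [Z [EX b0]]]]] := zone_first_symbol zX.
  by move: cX; rewrite EX content_holes.
have bk := ltn_ord b.
move: cX; rewrite EX content_cat content_holes /= ifT; last by lia.
case=> ba cZ; have zZ : zone Z by move: zX; rewrite EX zone_cat /= => /and3P[].
(* The first tally counts [a] itself, so the flip length comes out as [j.+1]. *)
have co1 : clean (rcons o 1) by rewrite clean_rcons co; lia.
have Ej : index (b : nat) (content Z) = j by rewrite cZ ba.
(* The hole left of the head joins the [h] holes before [b], so the initial [Y] has [h.+1] cells. *)
have [Y' [Z' [r1 cY' cZ' z' [sY' sZ']]]] :=
  @reach_flip b j (nseq h.+1 hole) Z (rcons o 1) (zone_holes _) zZ co1 b0 Ej.
exists (Y' ++ hole :: Z'); split.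
- rewrite -!catA; apply: reach_le; last first.
    apply: reach_trans.
      by apply: sweep_right => x /nseqP[-> _] /=; rewrite eqxx.
    apply: reach_step.
      rewrite /= ifF; last by lia.
      by rewrite ifF; [rewrite inord_val | lia].
    apply: reach_trans.
      by apply: (@reach_tally b); rewrite clean_cat clean_zone //= co; lia.
    move: r1; rewrite rcons_cat /= rev_cons rev_nseq -cats1.
    by rewrite -cats1 -!catA /=; apply.
  have jn : j.+1 <= n by apply: leq_trans rn; rewrite ltnS index_size.
  rewrite !(size_cat, size_nseq) /=.
  (* At most [n] passes cost [4 * W] each; the remaining [2 * W] pay for finding [b] and for the
     first tally. *)
  set W := (h + (size Z).+1 + size o + 2 * n + 8).
  have : j.+1 * (4 * (h.+1 + size Z + (size o + 1) + 2 * j + 5)) <= n * (4 * W).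
    by apply: leq_mul => //; rewrite /W; lia.
  have : 2 * W <= n * (2 * W) by rewrite leq_pmull //; lia.
  by rewrite /W; lia.
- rewrite content_cat /= eqxx cY' cZ' cZ content_holes cats0 //.
- move: z'; rewrite !zone_cat /= => /andP[-> ->]; lia.
- by rewrite !size_cat /= sY' sZ' !size_nseq; lia.
Qed.

(** A round lengthens the zone by [j.+1] cells and the output by [j.+2], at most [2 * n + 3] in all;
    the term [m * (2 * n + 3)] reserves this for the remaining rounds. *)
Lemma reach_greedy n m X o : zone X -> clean o -> size (content X) = m -> m <= n ->
  exists l,
    reach (m.+1 * (6 * n.+1 * (size X + size o + m * (2 * n + 3) + 2 * n + 8)))
      (Start, [:: hole], X ++ sep :: o)
      (Done, l, o ++ flip_word (greedy m (content X))).
Proof.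
elim: m X o => [|m IH] X o zX co sX mn.
  have [EX|[h [b [Z [EX b0]]]]] := zone_first_symbol zX; last first.
    have bk := ltn_ord b; move/size0nil: sX.
    by rewrite EX content_cat content_holes /= ifT //; lia.
  exists (sep :: rev X ++ [:: hole]); rewrite cats0.
  apply: (@reach_le _ _ (size X + 1)); first by nia.
  rewrite {2}EX; apply: reach_trans.
    rewrite -{1}(size_nseq (size X) hole); apply: sweep_right => y /nseqP[-> _] /=.
    by rewrite eqxx.
  rewrite -EX; apply: reach_step; last exact: reach_refl.
  by rewrite /= eqxx ifF //; lia.
case E: (content X) sX => [|a r] // [sr].
have rn : size r < n by rewrite sr.
have [X' [r1 cX' zX' sX']] := reach_round zX co E rn.
set j := index a r in r1 cX' sX'.
have co' : clean (o ++ rcons (nseq j.+1 1) 2).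
  by rewrite clean_cat co clean_rcons; apply/allP => x /nseqP[-> _]; lia.
have jr : j <= size r := index_size _ _.
have sX2 : size (content X') = m by rewrite cX' size_cat size_rev -size_cat cat_take_drop.
have [l r2] := IH X' _ zX' co' sX2 (ltnW mn).
exists l; rewrite -catA cX' in r2.
apply: reach_le (reach_trans r1 r2).
rewrite size_cat size_rcons size_nseq sX'.
set W := size X + size o + m.+1 * (2 * n + 3) + 2 * n + 8.
have le1 : 6 * n * (size X + size o + 2 * n + 8) <= 6 * n.+1 * W.
  by apply: leq_mul; rewrite /W; lia.
have le2 : m.+1 * (6 * n.+1 * (size X + j.+1 + (size o + j.+2) + m * (2 * n + 3) + 2 * n + 8))
    <= m.+1 * (6 * n.+1 * W).
  by rewrite leq_mul2l leq_mul2l /W mulSn; lia.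
by rewrite mulSn; apply: leq_add.
Qed.

(** * Short inputs by table lookup, long inputs by the greedy phase *)

Definition symbols (w : seq nat) : bool := all (fun x => 0 < x <= k) w.

Lemma reach_read (p : N.-bseq 'I_k.+1) l w r : symbols w -> size p + size w <= N ->
  exists p' : N.-bseq 'I_k.+1, map val p' = map val p ++ w /\
    reach (size w) (Read p, l, w ++ r) (Read p', rev w ++ l, r).
Proof.
elim: w p l => [|x w IH] p l; first by exists p; rewrite cats0; split; last constructor.
case/andP=> xk sw le_N.
(* Beyond length [N], [insub_bseq] would fall back to the empty word; the length bound excludes
   this. *)
have vp : insub_bseq N (rcons p (inord x : 'I_k.+1)) = rcons p (inord x) :> seq _.
  by rewrite /insub_bseq /insubd insubT //= size_rcons; move: le_N => /=; lia.
have [|p' [Ep r1]] := IH (insub_bseq N (rcons p (inord x : 'I_k.+1))) (x :: l) sw.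
  by rewrite vp size_rcons; move: le_N => /=; lia.
exists p'; split.
  by rewrite Ep vp map_rcons cat_rcons /= inordK //; lia.
rewrite rev_cons cat_rcons; apply: reach_step r1.
by rewrite /= ifF ?ifT //; move: le_N => /=; lia.
Qed.

(** Writing goes from right to left; the hypothesis on [behead r] is the invariant that the cells
    right of the head already hold the tail of the answer. *)
Lemma reach_write (p : N.-bseq 'I_k.+1) m l r :
  let o := flip_word (table p) in
  m.+1 <= size o -> size o <= B -> behead r = drop m.+1 o ->
  exists l', reach m.+1 (Write p (inord m.+1), l, r) (Write p ord0, l', o).
Proof.
move=> o; elim: m l r => [|m IH] l r mo oB Er.
  have E0 : inord 0 = ord0 :> 'I_B.+1 by apply: val_inj; rewrite /= inordK.
  exists l; apply: reach_step.
    by rewrite /= inordK; last lia.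
  rewrite E0 Er -drop_nth // drop0; exact: reach_refl.
have [l' r1] := IH (behead l) (head 0 l :: nth 0 o m.+1 :: behead r) (ltnW mo) oB
  (etrans (congr1 _ Er) (esym (drop_nth 0 mo))).
exists l'; apply: reach_step r1.
by rewrite /= inordK; last lia.
Qed.

Lemma short_run (w : seq nat) : symbols w -> size w <= N ->
  (forall p, size (flip_word (table p)) <= B) ->
  exists (p : N.-bseq 'I_k.+1) l r, [/\ map val p = w,
    take (find (fun x => x == 0) r) r = flip_word (table p) &
    reach (N + B.+1) (Read [bseq], [::], w) (Write p ord0, l, r)].
Proof.
move=> sw wN tB; have [p [Ep r1]] := @reach_read [bseq] [::] w [::] sw wN.
rewrite !cats0 in r1; exists p.
suff [l [r [Er r2]]] : exists l r, take (find (fun x => x == 0) r) r = flip_word (table p) /\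
    reach B (Write p (inord (size (flip_word (table p)))), rev w, [:: 0]) (Write p ord0, l, r).
  exists l, r; split=> //; apply: reach_le (reach_trans r1 (reach_step _ r2)) => //.
  by rewrite leq_add2r.
have := @reach_write p (size (flip_word (table p))).-1 (rev w) [:: 0].
have := tB p; case E: (size (flip_word (table p))) => [|m] /= mB.
  (* For an empty answer the head stays on the blank, which is read as the empty word. *)
  move=> _; exists (rev w), [:: 0]; split; first by rewrite (size0nil E).
  have -> : inord 0 = ord0 :> 'I_B.+1 by apply: val_inj; rewrite /= inordK.
  exact: reach_refl.
rewrite E -E drop_size => -[||//|l r2]; rewrite ?E //.
exists l, (flip_word (table p)); split; first exact: take_flip_word.
by rewrite -E; apply: reach_le r2; rewrite E.
Qed.

Lemma long_run (w : seq nat) : symbols w -> N < size w ->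
  exists l, reach (60 * (size w).+1 ^ 4).-1 (Read [bseq], [::], w)
    (Done, l, flip_word (greedy (size w) w)).
Proof.
move=> sw Nw.
have zw : zone w by apply: sub_all sw => x; lia.
have cw : content w = w by apply/all_filterP; apply: sub_all sw => x; lia.
have sN : size (take N w) = N by rewrite size_takel // ltnW.
have swt : symbols (take N w) by apply/allP => x /mem_take /(allP sw).
have [|p [Ep r1]] := @reach_read [bseq] [::] (take N w) (drop N w) swt.
  by rewrite sN.
have sp : size p = N by rewrite -(size_map val) Ep.
rewrite cat_take_drop cats0 in r1.
have Ed := drop_nth 0 Nw; set x := nth 0 w N in Ed; set v := drop N.+1 w in Ed.
have xw : x \in w by apply: mem_nth.
have [l r2] := @reach_greedy (size w) (size w) w [::] zw isT (congr1 size cw) (leqnn _).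
exists l; rewrite cw in r2.
have r3 : reach (size v + (size w + 1).+1).+1
    (Read p, rev (take N w), x :: v) (Start, [:: hole], w ++ [:: sep]).
  (* The stored word is full after [N] symbols, so reading [x] switches to [ToEnd]. *)
  apply: reach_step.
    by rewrite /= ifF ?sp ?ltnn //; move: (allP sw _ xw); lia.
  apply: reach_trans.
    rewrite -{2}(cats0 v); apply: sweep_right => y /mem_drop /(allP sw) /=.
    by case: y.
  have -> : rev v ++ x :: rev (take N w) = rev w ++ [::].
    by rewrite cats0 -{2}(cat_take_drop N w) Ed rev_cat rev_cons cat_rcons.
  apply: reach_step; first by [].
  apply: reach_trans; first by apply: sweep_cleanL (clean_zone zw); apply: Or31.
  by apply: reach_step; last exact: reach_refl.
(* The greedy phase dominates: with [n = size w] its bound is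
   [6 * n.+1 ^ 2 * (2 * n ^ 2 + 6 * n + 8)]. The predecessor leaves room for the fuel unit added by
   [machine_computes]. *)
rewrite Ed in r1; apply: reach_le (reach_trans r1 (reach_trans r3 r2)).
have sv : size v < size w by rewrite size_drop; lia.
rewrite sN /=; move: (size v) (size w) sv Nw => a n an Nn.
by rewrite !expnS expn0; nia.
Qed.

End GroupingMachine.

(** The greedy choice depends only on equalities between symbols, hence is invariant under injective
    renaming. *)
Lemma greedy_map_succ (m : nat) (w : seq nat) : greedy m (map succn w) = greedy m w.
Proof.
elim: m w => [|m IH] [|a r] //=.
by rewrite (index_map succn_inj) -map_take -map_drop -map_rev -map_cat IH.
Qed.

(** * The approximation ratio *)

Section RealBounds.

Local Open Scope R_scope.

(** This is the condition under which [n >= N] implies [n <= (1 + eps) * (n - k)], where [n - k]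
    bounds the grouping distance from below. *)
Lemma long_string_threshold (k : nat) (eps : R) : 0 < eps ->
  exists N : nat, (1 + eps) * INR k <= eps * INR N.
Proof.
move=> eps0; have [N HN] := INR_unbounded (((1 + eps) * INR k) / eps).
exists N; have -> : (1 + eps) * INR k = eps * (((1 + eps) * INR k) / eps) by field; lra.
by apply: Rmult_le_compat_l; lra.
Qed.

Lemma approx_ratio_long (eps : R) (k k' N n d : nat) : 0 < eps ->
  (1 + eps) * INR k <= eps * INR N ->
  (k' <= k)%N -> (N <= n)%N -> (n <= k' + d)%N -> INR n <= (1 + eps) * INR d.
Proof.
move=> eps0 HN /leP/le_INR lek /leP/le_INR leN /leP/le_INR.
by rewrite plus_INR; nra.
Qed.

Lemma approx_ratio_optimal (eps : R) (n d : nat) : 0 < eps ->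
  (n <= d)%N -> INR n <= (1 + eps) * INR d.
Proof. by move=> eps0 /leP/le_INR led; have := pos_INR d; nra. Qed.

End RealBounds.

Theorem theorem3p7 (k : nat) (eps : R) :
  2 <= k -> Rlt 0 eps ->
  exists (M : TM) (c : nat),
    k <= tm_S M /\
    forall (k' : nat) (s : seq nat),
      k' <= k -> kary k s -> normalized s -> fully_kary k' s ->
      exists fl : seq nat,
        computes_within M s (c * (size s).+1 ^ c) fl /\
        groups_with k' s fl /\
        (forall d : nat, is_grouping_distance k' s d ->
           Rle (INR (size fl)) (Rmult (Rplus 1 eps) (INR d))).
Proof.
move=> _ eps0.
have [N HN] := long_string_threshold k eps0.
(* [predn] undoes the shift by one in the tape encoding. *)
have [table Htable] := fin_all_exists
  (fun p : N.-bseq 'I_k.+1 => optimal_grouping (map predn (map val p))).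
pose B := \max_p size (flip_word (table p)).
have HB p : size (flip_word (table p)) <= B by apply: leq_bigmax.
(* The largest tape symbol is the mark [k.+3]. The constant is both factor and exponent: long inputs
   need factor 60 and exponent 4, short ones the time [N + B.+2], which does not depend on [s]. *)
exists (machine k.+3 (Read [bseq] : state k N B) (delta table)), (60 + N + B).
split=> [|k' s lekk ks ns fs]; first by rewrite /= -addn3 leq_addr.
have sS : symbols k (map succn s) by rewrite /symbols all_map.
have ks3 : all (fun x => x < k.+3) s by apply: sub_all ks => x; lia.
have [sN|Ns] := leqP (size s) N.
- have [|p [l [r [Ep Er rT]]]] := short_run sS _ HB; first by rewrite size_map.
  have Es : map predn (map val p) = s by rewrite Ep -map_comp map_id_in.
  have := Htable p k'; rewrite Es => /(_ ns fs) [gs opt].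
  exists (table p); split; last split=> // d [/opt le_d _].
    apply: computes_within_le (machine_computes (@delta_bound _ _ _ _) ks3 rT _ _) => //.
    + have : 0 < (size s).+1 ^ (60 + N + B) by rewrite expn_gt0.
      by nia.
    + by rewrite Er decode_flip_word.
  exact: approx_ratio_optimal.
- have [|l rT] := @long_run k N B table _ sS; first by rewrite size_map.
  exists (greedy (size s) s); split; last split=> [|d [gd _]].
  + apply: computes_within_le (machine_computes (@delta_bound _ _ _ _) ks3 rT _ _) => //.
      rewrite size_map prednK ?muln_gt0 ?expn_gt0 //.
      by apply: leq_mul; [lia | apply: leq_pexp2l; lia].
    by rewrite take_flip_word decode_flip_word greedy_map_succ size_map.
  + exact: groups_with_greedy.
  + rewrite size_greedy //.
    exact: (approx_ratio_long eps0 HN lekk (ltnW Ns) (groupable_lower_bound ns gd)).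
Qed.
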